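(* Let $L,M,N$ be positive integers and let $g:=\{g_l\}_{l\in\mathbb{N}_L}\subset\ell^2(\mathbb{Z}\times\mathbb{Z},\mathbb{H})$. If $\mathcal{G}(g,L,M,N)$ is a Parseval frame for $\ell^2(\mathbb{Z}\times\mathbb{Z},\mathbb{H})$, then $N^2\le LM^2$.
   Context: $\mathbb{H}$ is the algebra of real quaternions with imaginary units $i,j,ij$. For a positive integer $K$, $\mathbb{N}_K:=\{0,1,\dots,K-1\}$. $\ell^2(\mathbb{Z}\times\mathbb{Z},\mathbb{H})$ is the right quaternionic Hilbert space of functions $f:\mathbb{Z}^2\to\mathbb{H}$ with $\sum_{k\in\mathbb{Z}^2}|f(k)|^2<\infty$, with inner product $\langle f,g\rangle=\sum_{k\in\mathbb{Z}^2}\overline{f(k)}\,g(k)$. For $n\in\mathbb{Z}^2$, $(T_{nN}f)(k)=f(k-nN)$ where $nN=(n_1N,n_2N)$. For $m=(m_1,m_2)\in\mathbb{N}_M^2$, $(E_{\frac mM}f)(k)=e^{2\pi i\frac{m_1}{M}k_1}f(k)e^{2\pi j\frac{m_2}{M}k_2}$, $k=(k_1,k_2)\in\mathbb{Z}^2$. The Gabor system is $\mathcal{G}(g,L,M,N):=\{E_{\frac mM}T_{nN}g_l\}_{l\in\mathbb{N}_L,\,m\in\mathbb{N}_M^2,\,n\in\mathbb{Z}^2}$. It is a Parseval frame if for all $h\in\ell^2(\mathbb{Z}\times\mathbb{Z},\mathbb{H})$: $\sum_{l\in\mathbb{N}_L}\sum_{n\in\mathbb{Z}^2}\sum_{m\in\mathbb{N}_M^2}|\langle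 E_{\frac mM}T_{nN}g_l,h\rangle|^2=\|h\|^2$. *)

(* Defs.v *)
(* MathComp / MathComp-Analysis *)
From HB Require Import structures.
From mathcomp Require Import all_boot all_order all_algebra ring.
From mathcomp Require Import all_classical all_reals all_analysis.

Set Implicit Arguments.
Unset Strict Implicit.
Unset Printing Implicit Defensive.

Import Order.TTheory GRing.Theory Num.Theory.
Local Open Scope classical_set_scope.
Local Open Scope ring_scope.

(* Quat a b c d is the quaternion a + b i + c j + d ij. *)
Record quat (R : Type) := Quat { qre : R; qimi : R; qimj : R; qimk : R }.
Add Printing Constructor quat.

Section QuatRing.
Variable R : realType.
Implicit Types p q r : quat R.

Definition quat_to_tuple q := (qre q, qimi q, qimj q, qimk q).
Definition tuple_to_quat (t : R * R * R * R) :=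
  let: (a, b, c, d) := t in Quat a b c d.

Lemma quat_to_tupleK : cancel quat_to_tuple tuple_to_quat.
Proof. by case. Qed.

HB.instance Definition _ := Choice.copy (quat R) (can_type quat_to_tupleK).

Definition qzero : quat R := Quat 0 0 0 0.
Definition qone : quat R := Quat 1 0 0 0.
Definition qopp q := Quat (- qre q) (- qimi q) (- qimj q) (- qimk q).
Definition qadd p q :=
  Quat (qre p + qre q) (qimi p + qimi q) (qimj p + qimj q) (qimk p + qimk q).
Definition qmul p q :=
  Quat
    (qre p * qre q - qimi p * qimi q - qimj p * qimj q - qimk p * qimk q)
    (qre p * qimi q + qimi p * qre q + qimj p * qimk q - qimk p * qimj q)
    (qre p * qimj q - qimi p * qimk q + qimj p * qre q + qimk p * qimi q)
    (qre p * qimk q + qimi p * qimj q - qimj p * qimi q + qimk p * qre q).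

Lemma qaddA : associative qadd.
Proof. by move=> p q r; rewrite /qadd /= !addrA. Qed.
Lemma qaddC : commutative qadd.
Proof. by move=> p q; congr Quat; rewrite addrC. Qed.
Lemma qadd0 : left_id qzero qadd.
Proof. by case=> a b c d; rewrite /qadd /= !add0r. Qed.
Lemma qaddN : left_inverse qzero qopp qadd.
Proof. by move=> p; rewrite /qadd /= !addNr. Qed.

HB.instance Definition _ :=
  GRing.isZmodule.Build (quat R) qaddA qaddC qadd0 qaddN.

Lemma qmulA : associative qmul.
Proof. by move=> p q r; congr Quat => /=; ring. Qed.
Lemma qmul1l : left_id qone qmul.
Proof. by case=> a b c d; congr Quat => /=; ring. Qed.
Lemma qmul1r : right_id qone qmul.
Proof. by case=> a b c d; congr Quat => /=; ring. Qed.
Lemma qmulDl : left_distributive qmul qadd.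
Proof. by move=> p q r; congr Quat => /=; ring. Qed.
Lemma qmulDr : right_distributive qmul qadd.
Proof. by move=> p q r; congr Quat => /=; ring. Qed.
Lemma qone_neq0 : qone != 0.
Proof. by apply/eqP => -[] /eqP; rewrite oner_eq0. Qed.

HB.instance Definition _ := GRing.Zmodule_isNzRing.Build (quat R)
  qmulA qmul1l qmul1r qmulDl qmulDr qone_neq0.

Definition qreal (t : R) : quat R := Quat t 0 0 0.
Definition qi : quat R := Quat 0 1 0 0.
Definition qj : quat R := Quat 0 0 1 0.

Definition qconj q := Quat (qre q) (- qimi q) (- qimj q) (- qimk q).

Definition qabs q : R :=
  Num.sqrt (qre q ^+ 2 + qimi q ^+ 2 + qimj q ^+ 2 + qimk q ^+ 2).

(* The exponential e^(u t) for an imaginary unit u (u ^+ 2 = -1) and t real. *)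
Definition qexp (u : quat R) (t : R) : quat R :=
  qreal (cos t) + qreal (sin t) * u.

End QuatRing.
Arguments qi {R}.
Arguments qj {R}.

Section Gabor.
Variable R : realType.
Local Notation H := (quat R).
Implicit Types f g h : int * int -> H.

(* Unordered sums over a countable index set, following the library's treatment
   of signed sums: the positive and the negative part are summed separately.
   The value is only meaningful for absolutely summable families, such as
   the coordinates of conj(f k) * g k for square-summable f and g. *)
Definition rsum (I : choiceType) (u : I -> R) : R :=
  fine (esum [set: I] (EFin \o u)^\+ - esum [set: I] (EFin \o u)^\-)%E.

Definition qsum (I : choiceType) (u : I -> H) : H :=
  Quat (rsum (fun k => qre (u k))) (rsum (fun k => qimi (u k)))
       (rsum (fun k => qimj (u k))) (rsum (fun k => qimk (u k))).

Definition ell2 : set (int * int -> H) :=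
  [set f | (\esum_(k in [set: int * int]) (qabs (f k) ^+ 2)%:E < +oo)%E].

Definition inner f g : H := qsum (fun k => qconj (f k) * g k).

Definition l2norm f : R := Num.sqrt (qre (inner f f)).

Definition translation (N : nat) (n : int * int) f : int * int -> H :=
  fun k => f (k.1 - n.1 * N%:Z, k.2 - n.2 * N%:Z).

(* The two exponentials act on different sides and do not commute. *)
Definition modulation (M : nat) (m : 'I_M * 'I_M) f : int * int -> H :=
  fun k => qexp qi (2 * pi * (m.1%:R / M%:R) * k.1%:~R) * f k
           * qexp qj (2 * pi * (m.2%:R / M%:R) * k.2%:~R).

Definition gabor (L M N : nat) (g : 'I_L -> int * int -> H)
    (l : 'I_L) (m : 'I_M * 'I_M) (n : int * int) : int * int -> H :=
  modulation m (translation N n (g l)).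

Definition gabor_parseval_frame (L M N : nat) (g : 'I_L -> int * int -> H) :=
  forall h, ell2 h ->
    (\sum_(l < L) \esum_(n in [set: int * int]) \sum_(m : 'I_M * 'I_M)
       (qabs (inner (gabor N g l m n) h) ^+ 2)%:E)%E = (l2norm h ^+ 2)%:E.

End Gabor.

(* Main.v *)
(* Testing the Parseval identity on the unit masses at the N^2 points of a
   fundamental domain of (NZ)^2, where modulations have no effect on absolute
   values, and adding up gives N^2 = M^2 * sum_l ||g_l||^2.  Testing it on g_l
   itself and keeping only the term m = 0, n = 0 gives ||g_l||^4 <= ||g_l||^2,
   so ||g_l|| <= 1 and N^2 <= L M^2. *)
Require Import Defs.
From mathcomp Require Import all_boot all_order all_algebra ring.
From mathcomp Require Import all_classical all_reals all_analysis.

Set Implicit Arguments.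
Unset Strict Implicit.
Unset Printing Implicit Defensive.

Import Order.TTheory GRing.Theory Num.Theory.
Local Open Scope classical_set_scope.
Local Open Scope ring_scope.

(** * The squared modulus and its multiplicativity *)

Section Quaternions.
Variable R : realType.
Implicit Types p q : quat R.

Lemma qabs_sqr q :
  qabs q ^+ 2 = qre q ^+ 2 + qimi q ^+ 2 + qimj q ^+ 2 + qimk q ^+ 2.
Proof. by rewrite sqr_sqrtr// !addr_ge0 ?sqr_ge0. Qed.

Lemma qabs_sqrM p q : qabs (p * q) ^+ 2 = qabs p ^+ 2 * qabs q ^+ 2.
Proof. by rewrite !qabs_sqr /=; ring. Qed.

Lemma qabs_sqr_conj q : qabs (qconj q) ^+ 2 = qabs q ^+ 2.
Proof. by rewrite !qabs_sqr /= !sqrrN. Qed.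

Lemma qabs_sqr_qexp_qi (t : R) : qabs (qexp qi t) ^+ 2 = 1.
Proof. by rewrite qabs_sqr /= -[RHS](cos2Dsin2 t); ring. Qed.

Lemma qabs_sqr_qexp_qj (t : R) : qabs (qexp qj t) ^+ 2 = 1.
Proof. by rewrite qabs_sqr /= -[RHS](cos2Dsin2 t); ring. Qed.

Lemma qexp0 (u : quat R) : qexp u 0 = 1.
Proof. by rewrite /qexp cos0 sin0 (_ : qreal 0 = 0)// mul0r addr0. Qed.

Lemma qconj_mul_self q : qconj q * q = qreal (qabs q ^+ 2).
Proof. by rewrite qabs_sqr; congr Quat; rewrite /=; ring. Qed.

End Quaternions.

(** * Sums with a single nonzero term, and the tiling of the integer lattice *)

Section Sums.
Variable R : realType.

Lemma esum_supp1 (I : choiceType) (a : I -> \bar R) (k : I) :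
  (forall i, i != k -> a i = 0%E) -> (0 <= a k)%E ->
  (\esum_(i in [set: I]) a i)%E = a k.
Proof.
move=> a0 ak; rewrite -(@esum_set1 R I k a)// [RHS]esum_mkcond.
apply: eq_esum => i _; case: ifPn => //; rewrite notin_setE/= => /eqP ik.
exact: a0.
Qed.

(** The negative part vanishes. If the sum diverges, both sides take the default value 0 of
    [fine]. *)
Lemma rsum_ge0 (I : choiceType) (u : I -> R) : (forall i, 0 <= u i) ->
  rsum u = fine (\esum_(i in [set: I]) (u i)%:E)%E.
Proof.
move=> u0; rewrite /rsum [X in (_ - X)%E]esum1 ?sube0 => [|i _].
  congr fine; apply: eq_esum => i _.
  by rewrite funeposE; apply/max_idPl; rewrite lee_fin.
by rewrite funenegE; apply/max_idPr; rewrite /= lee_fin oppr_le0.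
Qed.

Lemma rsum_supp1 (I : choiceType) (u : I -> R) (k : I) :
  (forall i, i != k -> u i = 0) -> rsum u = u k.
Proof.
move=> u0; rewrite /rsum !(@esum_supp1 _ _ k) ?funepos_ge0 ?funeneg_ge0//.
- rewrite funeposE funenegE /= -!EFin_max /=.
  have [u_ge0|/ltW u_le0] := leP 0 (u k).
    by rewrite max_r ?oppr_le0// subr0.
  by rewrite max_l ?oppr_ge0// sub0r opprK.
- by move=> i ik; rewrite funenegE /= u0// oppr0 maxxx.
- by move=> i ik; rewrite funeposE /= u0// maxxx.
Qed.

Lemma qsum_supp1 (I : choiceType) (u : I -> quat R) (k : I) :
  (forall i, i != k -> u i = 0) -> qsum u = u k.
Proof.
move=> u0; rewrite /qsum !(@rsum_supp1 _ _ k); first by case: (u k).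
all: by move=> i ik; rewrite u0.
Qed.

Lemma esum_finType (I : finType) (a : I -> \bar R) : (forall i, 0 <= a i)%E ->
  (\esum_(i in [set: I]) a i = \sum_i a i)%E.
Proof.
move=> a0; rewrite esum_fset//; last exact: finite_finset.
rewrite [RHS](@bigfs _ _ _ _ _ predT) ?index_enum_uniq ?set_true//.
by move=> i; rewrite mem_index_enum.
Qed.

(** Division with remainder by [N] in each coordinate: the translates of the box of side [N] by
    multiples of [N] partition the lattice, so the double sum is a reindexing of the full one. *)
Lemma esum_tiling (N : nat) (a : int * int -> \bar R) : (0 < N)%N ->
  (forall z, 0 <= a z)%E ->
  (\sum_(k : 'I_N * 'I_N) \esum_(n in [set: int * int])
     a ((k.1 : nat)%:Z - n.1 * N%:Z, (k.2 : nat)%:Z - n.2 * N%:Z)%R =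
   \esum_(z in [set: int * int]) a z)%E.
Proof.
move=> N0 a0; rewrite -esum_finType; last by move=> k; exact: esum_ge0.
have Nn0 : N%:Z != 0 by rewrite eqz_nat -lt0n.
have inj1 (i j : 'I_N) (x y : int) :
    (i : nat)%:Z - x * N%:Z = (j : nat)%:Z - y * N%:Z -> i = j /\ x = y.
  (* Since the remainder [k] lies below [N], the quotient by [N] recovers the translation. *)
  move=> ij; have dv (k : 'I_N) (z : int) :
      (((k : nat)%:Z - z * N%:Z) %/ N%:Z)%Z = - z.
    rewrite addrC -mulNr divzMDl// divz_small ?addr0//.
    by rewrite lez_nat ltz_nat absz_nat ltn_ord.
  have xy : x = y by apply: oppr_inj; rewrite -(dv i) ij dv.
  split=> //; apply/val_inj/eqP.
  by rewrite -eqz_nat -(inj_eq (addIr (- (x * N%:Z)))) {2}xy ij.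
have surj1 (z : int) :
    exists (i : 'I_N) (x : int), z = (i : nat)%:Z - x * N%:Z.
  have zN : (`|(z %% N%:Z)%Z| < N)%N.
    by rewrite -ltz_nat gez0_abs ?modz_ge0// ltz_pmod.
  (* The quotient is negated because translations are subtracted. *)
  exists (Ordinal zN), (- (z %/ N%:Z)%Z) => /=.
  by rewrite gez0_abs ?modz_ge0// mulNr opprK addrC -divz_eq.
rewrite esum_esum//; symmetry.
apply: (@reindex_esum R _ _ _ _
  (fun p : ('I_N * 'I_N) * (int * int) =>
     ((p.1.1 : nat)%:Z - p.2.1 * N%:Z, (p.1.2 : nat)%:Z - p.2.2 * N%:Z)) a).
split=> //.
- move=> [[i1 i2] [x1 x2]] [[j1 j2] [y1 y2]] _ _ /= [].
  by move=> /inj1[-> ->] /inj1[-> ->].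
- move=> [z1 z2] _.
  have [i1 [x1 ->]] := surj1 z1; have [i2 [x2 ->]] := surj1 z2.
  by exists ((i1, i2), (x1, x2)).
Qed.

End Sums.

(** * Testing the Parseval identity *)

Section Gabor.
Variable R : realType.
Implicit Types f h : int * int -> quat R.

Definition qdelta (k : int * int) : int * int -> quat R :=
  fun x => (x == k)%:R.

Lemma inner_qdelta f k : inner f (qdelta k) = qconj (f k).
Proof.
rewrite /inner (@qsum_supp1 _ _ _ k) /qdelta; first by rewrite eqxx mulr1.
by move=> i /negPf ->; rewrite mulr0.
Qed.

Lemma inner_self f :
  inner f f
  = qreal (fine (\esum_(k in [set: int * int]) (qabs (f k) ^+ 2)%:E)%E).
Proof.
rewrite /inner /qsum; congr Quat.
  rewrite rsum_ge0 => [|k]; last by rewrite qconj_mul_self /= sqr_ge0.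
  by congr fine; apply: eq_esum => k _; rewrite qconj_mul_self.
(* The imaginary coordinates vanish everywhere, so any point, here the origin, can serve as the
   support. *)
all: by rewrite (@rsum_supp1 _ _ _ (0, 0)) => [|k _]; rewrite qconj_mul_self.
Qed.

Lemma qabs_sqr_qreal (t : R) : qabs (qreal t) ^+ 2 = t ^+ 2.
Proof. by rewrite qabs_sqr /= !expr0n /= !addr0. Qed.

Lemma l2norm_sqr f :
  l2norm f ^+ 2 = fine (\esum_(k in [set: int * int]) (qabs (f k) ^+ 2)%:E)%E.
Proof.
rewrite /l2norm inner_self /= sqr_sqrtr//; apply/fine_ge0/esum_ge0 => k _.
by rewrite lee_fin sqr_ge0.
Qed.

Lemma esum_qdelta k :
  (\esum_(x in [set: int * int]) (qabs (qdelta k x) ^+ 2)%:E = 1)%E.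
Proof.
rewrite (@esum_supp1 _ _ _ k) /qdelta.
- by rewrite eqxx qabs_sqr /= expr1n !expr0n /= !addr0.
- by move=> i /negPf ->; rewrite qabs_sqr /= !expr0n /= !addr0.
- by rewrite lee_fin sqr_ge0.
Qed.

(** The modulus is multiplicative and both exponentials have modulus 1, so the sides on which they
    act do not matter. *)
Lemma qabs_sqr_gabor (L M N : nat) (g : 'I_L -> int * int -> quat R) l
    (m : 'I_M * 'I_M) n k :
  qabs (gabor N g l m n k) ^+ 2
  = qabs (g l (k.1 - n.1 * N%:Z, k.2 - n.2 * N%:Z)) ^+ 2.
Proof.
by rewrite /gabor /modulation !qabs_sqrM qabs_sqr_qexp_qi qabs_sqr_qexp_qj
   mulr1 mul1r.
Qed.

Lemma gabor0 (L M N : nat) (g : 'I_L -> int * int -> quat R) l (o : 'I_M) :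
  o = 0%N :> nat -> gabor N g l (o, o) (0, 0) = g l.
Proof.
move=> o0; apply/funext => -[k1 k2]; rewrite /gabor /modulation /translation /=.
by rewrite o0 !(mul0r, mulr0, subr0) !qexp0 mul1r mulr1.
Qed.

Lemma gabor_parseval_norm_le1 (L M N : nat) (g : 'I_L -> int * int -> quat R)
    (l : 'I_L) : (0 < M)%N -> ell2 (g l) -> gabor_parseval_frame M N g ->
  (\esum_(k in [set: int * int]) (qabs (g l k) ^+ 2)%:E <= 1)%E.
Proof.
move=> M0 gl /(_ _ gl).
rewrite l2norm_sqr.
set S := (\esum_(k in [set: int * int]) _)%E.
have S0 : (0 <= S)%E by apply: esum_ge0 => k _; rewrite lee_fin sqr_ge0.
(* Square summability of [g l] enters here: it ensures that [fine S] is really [S] and not a default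
   value. *)
have Sfin : S \is a fin_num by rewrite ge0_fin_numE.
rewrite fineK// => eqS.
have : (S ^+ 2 <= S)%E.
  (* All terms are nonnegative, so one may drop first the other generators, then the nonzero
     translations, then the nonzero modulations. What remains is the squared modulus of the inner
     product of [g l] with itself, which is [S ^+ 2]. *)
  rewrite -[leRHS]eqS (bigD1 l)//=; apply: (le_trans _ (leeDl _ _)); last first.
    apply: sume_ge0 => i _; apply: esum_ge0 => n _; apply: sume_ge0 => m _.
    by rewrite lee_fin sqr_ge0.
  apply: esum_ge; exists [set (0, 0)]; first by split.
  rewrite fsbig_set1 (bigD1 (Ordinal M0, Ordinal M0))//=.
  apply: (le_trans _ (leeDl _ _)); last first.
    by apply: sume_ge0 => m _; rewrite lee_fin sqr_ge0.
  by rewrite gabor0// inner_self qabs_sqr_qreal -/S EFin_expe fineK.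
rewrite -(fineK Sfin) -EFin_expe !lee_fin => S2.
rewrite leNgt; apply/negP => S1.
by move: S2; rewrite expr2 leNgt ltr_pMr ?S1// (lt_trans ltr01).
Qed.

Lemma gabor_parseval_norm_sum (L M N : nat) (g : 'I_L -> int * int -> quat R) :
  (0 < N)%N -> gabor_parseval_frame M N g ->
  (\sum_(l < L) \sum_(m : 'I_M * 'I_M)
     \esum_(k in [set: int * int]) (qabs (g l k) ^+ 2)%:E = (N ^ 2)%:R%:E)%E.
Proof.
move=> N0 frame.
(* Pairing with the unit mass at [k] gives the conjugate of the value at [k]; its modulus does not
   depend on [m]. *)
have frame_delta (k : int * int) :
  (\sum_(l < L) \sum_(m : 'I_M * 'I_M) \esum_(n in [set: int * int])
     (qabs (g l (k.1 - n.1 * N%:Z, k.2 - n.2 * N%:Z)%R) ^+ 2)%:E = 1)%E.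
  have := frame (qdelta k); rewrite /ell2 /= l2norm_sqr esum_qdelta.
  move=> /(_ (ltry _)) <-; apply: eq_bigr => l _.
  rewrite -esum_sum => [|n m _ _]; last by rewrite lee_fin sqr_ge0.
  apply: eq_esum => n _; apply: eq_bigr => m _.
  by rewrite inner_qdelta qabs_sqr_conj qabs_sqr_gabor.
transitivity (\sum_(k : 'I_N * 'I_N) (1 : \bar R))%E; last first.
  by rewrite sumEFin sumr_const card_prod card_ord mulnn.
under [RHS]eq_bigr => k _ do
  rewrite -(frame_delta ((k.1 : nat)%:Z, (k.2 : nat)%:Z)).
(* Moving the sum over box points [k] inside, next to the sum over translations [n], lets the tiling
   merge the two into the full norm of [g l]. *)
rewrite [RHS]exchange_big; apply: eq_bigr => l _.
rewrite [RHS]exchange_big; apply: eq_bigr => m _.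
rewrite -(@esum_tiling _ N)// => z.
by rewrite lee_fin sqr_ge0.
Qed.

End Gabor.

Theorem proposition3 (R : realType) (L M N : nat)
    (hL : (0 < L)%N) (hM : (0 < M)%N) (hN : (0 < N)%N)
    (g : 'I_L -> int * int -> quat R)
    (hg : forall l : 'I_L, ell2 (g l)) :
  gabor_parseval_frame M N g -> (N ^ 2 <= L * M ^ 2)%N.
Proof.
move=> frame; rewrite -(ler_nat R) -lee_fin -(gabor_parseval_norm_sum hN frame).
apply: (@le_trans _ _ (\sum_(l < L) \sum_(m : 'I_M * 'I_M) 1)%E).
  apply: lee_sum => l _; apply: lee_sum => m _.
  exact: gabor_parseval_norm_le1 frame.
under eq_bigr do rewrite sumEFin sumr_const card_prod card_ord mulnn.
by rewrite sumEFin sumr_const card_ord -mulrnA mulnC.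
Qed.
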